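(* Let $(G,\mathcal{T})$ be a non-metrizable one-parametric topological group. Then $(G,\mathcal{T})$ is monothetic if and only if the $\mathbb{N}$-scaling $\mathcal{T}'$ of its topology $\mathcal{T}$ does not contain the Borel-Bohr topology $\mathcal{T}^\natural$ of $(G,\mathcal{T})$ (that is, $\mathcal{T}^\natural\not\subseteq\mathcal{T}'$).
   Context: All topological groups are assumed to be Hausdorff; $\mathbb{N}$ is the set of positive integers; groups are written additively. A topological group $G$ is one-parametric if there exists a surjective continuous group homomorphism $\phi:\mathbb{R}\to G$, where $\mathbb{R}$ is the additive group of reals with the Euclidean topology (so $G$ is abelian). A topological group $G$ is monothetic if there exists $g\in G$ such that the cyclic subgroup $\{ng:n\in\mathbb{Z}\}$ is dense in $G$. For a topological abelian group $(G,\mathcal{T})$, let $\mathcal{T}_0=\{U\in\mathcal{T}:0\in U\}$; the $\mathbb{N}$-scaling $\mathcal{T}'$ of $\mathcal{T}$ is the (Hausdorff group) topology on $G$ generated by the base $\{g+nU: g\in G,\ n\in\mathbb{N},\ U\in\mathcal{T}_0\}$, where $nU=\{nu:u\in U\}$. Let $\mathbb{T}=\{z\in\mathbb{C}:|z|=1\}$ be the circle group. A function between topological spaces is Borel if the preimage of every open set is a Borel set. The Borel-Bohr topology $\mathcal{T}^\natural$ on a topological abelian group $(G,\mathcal{T})$ is the smallest topology on $G$ in which all Borel homomorphisms from $(G,\mathcal{T})$ to $\mathbb{T}$ are continuous. *)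

(* Defs.v *)
From HB Require Import structures.
From mathcomp Require Import all_boot all_order all_algebra.
From mathcomp Require Import all_classical all_reals all_analysis.
From mathcomp Require Import complex.

Set Implicit Arguments.
Unset Strict Implicit.
Unset Printing Implicit Defensive.

Import Order.TTheory GRing.Theory Num.Theory.
Import numFieldNormedType.Exports.

Local Open Scope classical_set_scope.
Local Open Scope ring_scope.

Definition metrizable (R : realType) (T : topologicalType) : Prop :=
  exists (M : metricType R) (f : T -> M) (g : M -> T),
    [/\ cancel f g, cancel g f, continuous f & continuous g].

Definition one_parametric (R : realType) (G : topologicalZmodType) : Prop :=
  exists phi : {additive R -> G}, continuous phi /\ range phi = [set: G].

Definition monothetic (G : topologicalZmodType) : Prop :=
  exists g : G, dense (range (fun n : int => g *~ n)).

Section Nscaling.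
Variable G : topologicalZmodType.

Definition scaled_translate (g : G) (n : nat) (U : set G) : set G :=
  [set g + u *+ n | u in U].

Definition Nscaling_base : set_system G :=
  [set B | exists (g : G) (n : nat) (U : set G),
     [/\ (0 < n)%N, open U, U 0 & B = scaled_translate g n U]].

Lemma Nscaling_base_cover : \bigcup_(B in Nscaling_base) B = [set: G].
Proof.
apply/seteqP; split=> // x _.
exists (scaled_translate x 1 [set: G]).
  by exists x, 1%N, [set: G]; split=> //; exact: openT.
by exists 0 => //; rewrite mul0rn addr0.
Qed.

Lemma Nscaling_base_join (A B : set G) (x : G) :
  Nscaling_base A -> Nscaling_base B -> A x -> B x ->
  exists C, [/\ Nscaling_base C, C x & C `<=` A `&` B].
Proof.
move=> [g [n [U [n0 oU U0 ->]]]] [h [m [V [m0 oV V0 ->]]]].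
move=> [u Uu ux] [v Vv vx].
have contMn (c : G) (k : nat) : continuous (fun w : G => c + w *+ k).
  elim: k => [|k IHk] w; first by under eq_fun do rewrite mulr0n; exact: cvg_cst.
  have -> : (fun w0 : G => c + w0 *+ k.+1) =
            (fun z : G * G => z.1 + z.2) \o (fun w0 => (c + w0 *+ k, w0)).
    by apply: funext => w0 /=; rewrite mulrSr addrA.
  apply: continuous_comp; last exact: add_continuous.
  by apply: cvg_pair => /=; [exact: IHk|exact: cvg_id].
pose W := ((fun w => u + w *+ m) @^-1` U) `&` ((fun w => v + w *+ n) @^-1` V).
exists (scaled_translate x (n * m) W); split.
- exists x, (n * m)%N, W; split=> //; first by rewrite muln_gt0 n0.
  + by apply: openI; [move/continuousP: (contMn u m)|
      move/continuousP: (contMn v n)]; exact.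
  + by split; rewrite /= mul0rn addr0.
- exists 0; first by split; rewrite /= mul0rn addr0.
  by rewrite mul0rn addr0.
- move=> _ [w [wU wV] <-]; split.
  + by exists (u + w *+ m) => //; rewrite mulrnDl addrA ux -mulrnA mulnC.
  + by exists (v + w *+ n) => //; rewrite mulrnDl addrA vx -mulrnA.
Qed.

(* A copy of [G] carrying the topology generated by [Nscaling_base]. *)
Definition Nscaling : Type := G.

HB.instance Definition _ := Choice.on Nscaling.
HB.instance Definition _ := @isBaseTopological.Build Nscaling
  (set G) Nscaling_base id Nscaling_base_cover Nscaling_base_join.

Definition Nscaling_topology : set_system G := @open Nscaling.

End Nscaling.

Arguments Nscaling_topology : clear implicits.

(* [R[i]^o] rather than [R[i]]: the norm topology of a [numFieldType] is only
   inferred through the alias [_^o].  [circle R] has the subspace topology. *)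
Definition circle (R : realType) : Type :=
  set_type [set z : R[i]^o | `|z| = 1].

HB.instance Definition _ (R : realType) := Topological.on (circle R).

Definition Borel_fun (S T : topologicalType) (f : S -> T) : Prop :=
  forall U : set T, open U -> <<s @open S >> (f @^-1` U).

Definition circle_hom (R : realType) (G : zmodType) (f : G -> circle R) : Prop :=
  forall x y : G, \val (f (x + y)) = \val (f x) * \val (f y).

Section BorelBohr.
Variables (R : realType) (G : topologicalZmodType).

Definition Borel_character : Type :=
  {f : G -> circle R | Borel_fun f /\ circle_hom f}.

(* A copy of [G]: the supremum of the initial topologies of the Borel
   characters is the smallest topology making all of them continuous. *)
Definition Borel_Bohr : Type :=
  sup_topology (fun f : Borel_character =>
    Topological.class (initial_topology (sval f))).

HB.instance Definition _ := Topological.on Borel_Bohr.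

Definition Borel_Bohr_topology : set_system G := @open Borel_Bohr.

End BorelBohr.

Arguments Borel_Bohr_topology : clear implicits.

(* Main.v *)
Require Import Defs.
From HB Require Import structures.
From mathcomp Require Import all_boot all_order all_algebra.
From mathcomp Require Import all_classical all_reals all_analysis.
From mathcomp Require Import measurable_realfun.
From mathcomp Require Import complex ring lra.

(** Let [phi : R -> G] be a continuous surjective homomorphism.  A closed
    subgroup of the line is the whole line or [b Z]
    ([closed_subgroup_real]).  If [phi] had a nonzero kernel, [G] would be
    trivial or a circle, hence metrizable ([noninjective_metrizable]); so [phi]
    is injective and [G] is the line with a coarser group topology.

    The Borel structure does not see the coarsening: open sets of the line are
    countable unions of compact sets, whose images are closed
    ([open_image_Borel]).  Since measurable homomorphisms from the line to the
    circle are continuous (by Steinhaus' theorem, [steinhaus]), the Borel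
    characters of [G] are exactly the usual characters of the line
    ([Borel_character_along_line]).  A character [f] is continuous for the
    scaled topology exactly when [x |-> f (n x)] is continuous on [G] for some
    [n > 0].  So the question is which characters have a multiple that is
    continuous on [G].

    If the multiples of [g = phi a] are dense, let [f] have period [a] along
    the line.  Every [x |-> f (n x)] is trivial on a dense subgroup without
    being trivial, so it is discontinuous, and [f] witnesses that the
    Borel-Bohr topology is not contained in the scaled one
    ([monothetic_not_Borel_Bohr_sub]).

    Conversely, let [f] be a Borel character, let [a] be a nonzero period of it
    along the line ([rotation_has_period]), and let [K] be the closure of the
    multiples of [phi a].  If [K = G], then [G] is monothetic.  Otherwise [K]
    corresponds to a lattice [b Z] with [a = m b].  The character
    [x |-> f (m x)] is trivial on [K], and [G / K], being a Hausdorff image of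
    the compact circle [R / b Z], has the topology of that circle; so
    [x |-> f (m x)] is continuous on [G]
    ([rotation_continuous_at0_along_lattice]).  If [G] is not monothetic, this
    happens for every [f], and the Borel-Bohr topology is contained in the
    scaled one ([not_Borel_Bohr_sub_monothetic]). *)

Set Implicit Arguments.
Unset Strict Implicit.
Unset Printing Implicit Defensive.

Import Order.TTheory GRing.Theory Num.Theory.
Import numFieldNormedType.Exports.

Local Open Scope classical_set_scope.
Local Open Scope ring_scope.

(** * Circle-valued homomorphisms as cosine-sine pairs *)

(** The real and imaginary parts of a homomorphism [V -> T].  Working with the
    pair keeps continuity, measurability and the intermediate value theorem
    inside the reals. *)
Definition rotation (R : realType) (V : zmodType) (c s : V -> R) : Prop :=
  [/\ forall x, c x ^+ 2 + s x ^+ 2 = 1,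
      forall x y, c (x + y) = c x * c y - s x * s y
    & forall x y, s (x + y) = s x * c y + c x * s y].

Section rotation_theory.
Context {R : realType} {V : zmodType} (c s : V -> R).
Hypothesis rcs : rotation c s.

Lemma rotation0 : c 0 = 1 /\ s 0 = 0.
Proof.
have [cs cD sD] := rcs.
have := cs 0; have := cD 0 0; have := sD 0 0; rewrite addr0.
move: (c 0) (s 0) => u v hv hu huv.
have [v0|v0] := eqVneq v 0; first by split=> //; nra.
(* From [v = 2 u v] with [v <> 0]: then [u = u^2 - v^2] contradicts the norm. *)
have u2 : u = 2^-1.
  by apply: (mulfI v0); lra.
by exfalso; rewrite u2 in hu huv; nra.
Qed.

Lemma rotationN x : c (- x) = c x /\ s (- x) = - s x.
Proof.
have [cs cD sD] := rcs; have [c0 s0] := rotation0.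
have := cD x (- x); have := sD x (- x); rewrite subrr c0 s0 => hs hc.
have := cs x; move: hs hc; move: (c x) (s x) (c (- x)) (s (- x)) => u v a b.
move=> hs hc h; split.
  have -> : a = (u ^+ 2 + v ^+ 2) * a by rewrite h mul1r.
  have -> : (u ^+ 2 + v ^+ 2) * a = u * (u * a - v * b) + v * (v * a + u * b)
    by ring.
  by rewrite -hs -hc; ring.
have -> : b = (u ^+ 2 + v ^+ 2) * b by rewrite h mul1r.
have -> : (u ^+ 2 + v ^+ 2) * b = u * (v * a + u * b) - v * (u * a - v * b)
  by ring.
by rewrite -hs -hc; ring.
Qed.

Lemma rotation_cB x y : c (x - y) = c x * c y + s x * s y.
Proof.
have [_ cD _] := rcs; have [cN sN] := rotationN y.
by rewrite cD cN sN; ring.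
Qed.


(** The chord between two points of the circle is governed by [1 - c] at their
    difference; so [1 - c] small near 0 is the only continuity condition that
    ever has to be checked. *)
Lemma rotation_dist x y :
  (c x - c y) ^+ 2 + (s x - s y) ^+ 2 = 2 * (1 - c (x - y)).
Proof.
have [cs _ _] := rcs; rewrite rotation_cB.
have := cs x; have := cs y; move: (c x) (s x) (c y) (s y) => u v a b h1 h2.
have -> : (u - a) ^+ 2 + (v - b) ^+ 2 =
  (u ^+ 2 + v ^+ 2) + (a ^+ 2 + b ^+ 2) - 2 * (u * a + v * b) by ring.
by rewrite h1 h2; ring.
Qed.

Lemma rotation_le1 x : c x <= 1.
Proof.
have := rotation_dist x 0; rewrite subr0 => h.
have := addr_ge0 (sqr_ge0 (c x - c 0)) (sqr_ge0 (s x - s 0)).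
by rewrite h; lra.
Qed.

Lemma rotation_double x : c (x *+ 2) = 2 * c x ^+ 2 - 1.
Proof.
have [cs cD _] := rcs; rewrite mulr2n cD; have := cs x; lra.
Qed.

Lemma rotation_period x a : c a = 1 -> c (x + a) = c x /\ s (x + a) = s x.
Proof.
have [cs cD sD] := rcs => ca.
have sa : s a = 0 by apply/eqP; rewrite -sqrf_eq0; apply/eqP; have := cs a;
  rewrite ca; lra.
by rewrite cD sD ca sa; split; ring.
Qed.

Lemma rotation_period_int x a (k : int) : c a = 1 -> c (x + a *~ k) = c x.
Proof.
move=> ca.
have pn : forall (n : nat) y, c (y + a *+ n) = c y.
  elim=> [|n IH] y; first by rewrite addr0.
  by rewrite mulrSr addrA (rotation_period _ ca).1.
case: k => n; first exact: pn.
by rewrite NegzE mulrNz -[in RHS](subrK (a *+ n.+1) x) pn.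
Qed.

End rotation_theory.

(** * Closed subgroups of the real line *)

Lemma floor_div_itv (R : realType) (x y : R) :
  0 < x -> 0 <= y - x *~ Num.floor (y / x) < x.
Proof.
move=> x0; have /andP[h1 h2] := floor_itv (y / x).
rewrite -mulrzr subr_ge0 mulrC -ler_pdivlMr// h1/= ltrBlDr.
by move: h2; rewrite ltr_pdivrMr// intrD; lra.
Qed.


(** The generator is the infimum [b] of the positive elements.  If [b = 0] the
    subgroup has arbitrarily small steps, hence is dense.  If [b > 0], two
    distinct elements are at least [b] apart, so [b] itself belongs to the
    subgroup and the remainder of any element modulo [b] vanishes.  The
    trivial subgroup is the case [b = 0] of the second alternative. *)
Lemma closed_subgroup_real (R : realType) (S : set R) :
  closed S -> S 0 -> (forall x y, S x -> S y -> S (x - y)) ->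
  S = setT \/ exists2 b : R, 0 <= b & S = range (fun k : int => b *~ k).
Proof.
move=> cS S0 SB.
have SN x : S x -> S (- x) by move=> Sx; rewrite -sub0r; exact: SB.
have SD x y : S x -> S y -> S (x + y).
  by move=> Sx Sy; rewrite -[y]opprK; apply: SB => //; exact: SN.
have SM x (k : int) : S x -> S (x *~ k).
  have Sn : forall n : nat, S x -> S (x *+ n).
    by elim=> [|n IH] Sx; rewrite ?mulr0n// mulrSr; apply: SD => //; exact: IH.
  by case: k => n Sx; [exact: Sn|rewrite NegzE mulrNz; exact/SN/Sn].
pose P := [set x | S x /\ 0 < x].
have [[p Pp]|nP] := pselect (P !=set0); last first.
  right; exists 0 => //; apply/seteqP; split=> [x Sx|_ [k _ <-]]; last first.
    by rewrite mul0rz.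
  exists 0 => //; rewrite mulr0z; apply/eqP; rewrite eq_sym; apply/negPn/negP.
  move=> x0; apply: nP; have [xp|xn] := ltP 0 x; first by exists x.
  by exists (- x); split; [exact: SN|rewrite oppr_gt0 lt_neqAle x0].
have hP : has_inf P by split; [exists p|exists 0 => x [_ /ltW]].
pose b := inf P.
have b0 : 0 <= b by apply: lb_le_inf; [exists p|move=> x [_ /ltW]].
have [b0'|bpos] := leP b 0.
  left; apply/seteqP; split=> // y _; apply: cS => U /nbhs_ballP[e /= e0 eU].
  have [x [Sx x0] xe] := inf_adherent e0 hP.
  exists (x *~ Num.floor (y / x)); split; first exact: SM.
  apply: eU; have /andP[h1 h2] := floor_div_itv y x0.
  by rewrite /ball/= ger0_norm//; rewrite -/b in xe; lra.
right; exists b => //.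
(* Otherwise two elements of [P] in [[b, 2 b[] have a difference in [P] below [b]. *)
have Sb : S b.
  have [x [Sx x0] xe] := inf_adherent bpos hP; rewrite -/b in xe.
  have bx : b <= x by apply: ge_inf; [exact: hP.2|split].
  move: bx; rewrite le_eqVlt => /orP[/eqP->//|bx].
  have xb : 0 < x - b by lra.
  have [y [Sy y0] ye] := inf_adherent xb hP; rewrite -/b in ye.
  have by_ : b <= y by apply: ge_inf; [exact: hP.2|split].
  have : b <= x - y.
    by apply: ge_inf; [exact: hP.2|split; [exact: SB|lra]].
  by lra.
apply/seteqP; split=> [y Sy|_ [k _ <-]]; last exact: SM.
exists (Num.floor (y / b)) => //.
have /andP[h1 h2] := floor_div_itv y bpos.
move: h1; rewrite le_eqVlt => /orP[/eqP|h1]; first by move/eqP; rewrite eq_sym subr_eq0 => /eqP.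
have : b <= y - b *~ Num.floor (y / b).
  by apply: ge_inf; [exact: hP.2|split=> //; apply: SB => //; exact: SM].
by rewrite leNgt h2.
Qed.

(** * A one-parametric group with a kernel is metrizable *)

Lemma rotation_cos_sin (R : realType) (w : R) :
  rotation (fun x => cos (w * x)) (fun x => sin (w * x)).
Proof.
split=> [x|x y|x y]; first exact: cos2Dsin2.
  by rewrite mulrDr cosD.
by rewrite mulrDr sinD.
Qed.


(** Reduce to [[0, 2 pi[], where [1 - cos y = 2 sin (y / 2) ^ 2] vanishes only
    at 0. *)
Lemma cos_eq1 (R : realType) (x : R) :
  cos x = 1 -> exists k : int, x = (pi *+ 2) *~ k.
Proof.
move=> cx; have p0 : 0 < pi *+ 2 :> R by rewrite pmulrn_lgt0// pi_gt0.
set k := Num.floor (x / (pi *+ 2)); exists k.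
have /andP[] := floor_div_itv x p0; rewrite -/k.
set y := x - _ => y0 y1.
have cy : cos y = 1.
  have := @rotation_period_int R R _ _ (rotation_cos_sin 1) x (pi *+ 2) (- k).
  by rewrite !mul1r cos2pi => /(_ erefl); rewrite mulrNz -/y cx.
suff : y = 0 by move/eqP; rewrite subr_eq0 => /eqP.
move: y0; rewrite le_eqVlt => /orP[/eqP//|y0].
have : 0 < sin (y / 2) by apply: sin_gt0_pi; apply/andP; split; lra.
have h2 : y = (y / 2) *+ 2 by rewrite mulr2n -splitr.
move: cy; rewrite {1}h2 cos_mulr2n cos2sin2 => h; nra.
Qed.


(** A continuous map from a compact set onto a Hausdorff space is a quotient
    map, since it sends closed sets to closed sets. *)
Lemma compact_quotient_continuous (X T U : topologicalType) (A : set X)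
    (p : X -> T) (q : T -> U) :
  hausdorff_space T -> compact A -> continuous p -> p @` A = [set: T] ->
  continuous (q \o p) -> continuous q.
Proof.
move=> hT cA cp pA cqp; apply/continuous_closedP => C cC.
have -> : q @^-1` C = p @` (A `&` (q \o p) @^-1` C).
  apply/seteqP; split=> [t qt|_ [x [_ Cx] <-]//].
  have : [set: T] t by []; rewrite -pA => -[x Ax xt].
  by exists x => //; split=> //=; rewrite xt.
apply: compact_closed => //; apply: continuous_compact.
  exact: continuous_subspaceT.
by apply: compact_closedI => //; exact: (proj1 (continuous_closedP _) cqp).
Qed.


(** A copy of [T] with the taxicab metric pulled back along an injection into
    the plane. *)
Section pair_metric.
Context {R : realType} {T : choiceType} (c s : T -> R).

Definition pair_metric
  (inj : forall x y, c x = c y -> s x = s y -> x = y) : Type := T.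

Hypothesis inj : forall x y, c x = c y -> s x = s y -> x = y.
HB.instance Definition _ := Choice.on (pair_metric inj).

Let dist (x y : pair_metric inj) : R := `|c x - c y| + `|s x - s y|.

Let distxx x : dist x x = 0.
Proof. by rewrite /dist !subrr normr0 addr0. Qed.

Let dist_positivity x y : dist x y = 0 -> x = y.
Proof.
move=> /eqP; rewrite paddr_eq0 ?normr_ge0// !normr_eq0 !subr_eq0.
by move=> /andP[/eqP cxy /eqP sxy]; exact: inj.
Qed.

Let dist_sym x y : dist x y = dist y x.
Proof. by rewrite /dist distrC (distrC (s x)). Qed.

Let dist_triangle y x z : dist x z <= dist x y + dist y z.
Proof. by rewrite /dist addrACA lerD// ler_distD. Qed.

HB.instance Definition _ := @isMetric.Build R (pair_metric inj)
  dist distxx dist_positivity dist_sym dist_triangle.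

Lemma pair_metric_ballE (x : pair_metric inj) (e : R) :
  ball x e = [set y | `|c x - c y| + `|s x - s y| < e].
Proof. by []. Qed.

End pair_metric.


(** The identity from [T] to its metric copy is continuous, hence a
    homeomorphism by compactness. *)
Lemma compact_metrizable_of_coordinates (R : realType) (T : topologicalType) (c s : T -> R) :
  compact [set: T] -> hausdorff_space T -> continuous c -> continuous s ->
  (forall x y, c x = c y -> s x = s y -> x = y) -> metrizable R T.
Proof.
move=> cT hT cc cs inj.
pose f : T -> pair_metric inj := id.
have cf : continuous f.
  move=> x; apply/cvg_ballP => e e0; have e20 : 0 < e / 2 by rewrite divr_gt0.
  apply: filterS2 (cvgr_dist_lt _ _ (cc x) _ e20) (cvgr_dist_lt _ _ (cs x) _ e20).
  by move=> y cy sy; rewrite pair_metric_ballE /= (splitr e) ltrD.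
exists (pair_metric inj), f, id; split=> //.
apply: (@compact_quotient_continuous _ _ _ setT f) => //.
- exact: metric_hausdorff.
- by apply/seteqP; split=> // x _; exists x.
- by move=> x; exact: cvg_id.
Qed.

Lemma continuous_cosM (R : realType) (w : R) : continuous (fun x => cos (w * x)).
Proof.
move=> x; apply: (@continuous_comp _ _ _ (fun x => w * x) cos).
  exact: mulrl_continuous.
exact: continuous_cos.
Qed.

Lemma continuous_sinM (R : realType) (w : R) : continuous (fun x => sin (w * x)).
Proof.
move=> x; apply: (@continuous_comp _ _ _ (fun x => w * x) sin).
  exact: mulrl_continuous.
exact: continuous_sin.
Qed.

Lemma continuous_preimage_closed (S T : topologicalType) (f : S -> T) (C : set T) :
  continuous f -> closed C -> closed (f @^-1` C).
Proof. by move=> /continuous_closedP cf; exact: cf. Qed.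

Lemma hausdorff_closed1 (T : topologicalType) (x : T) :
  hausdorff_space T -> closed [set x].
Proof. by move=> hT; exact/accessible_closed_set1/hausdorff_accessible. Qed.


(** The kernel is a nonzero closed subgroup of the line.  If it is the whole
    line, the group is trivial.  If it is [b Z], the group is the image of the
    compact interval [[0, b]], and the cosine and sine of period [b] descend to
    continuous coordinates that separate its points. *)
Lemma noninjective_metrizable (R : realType) (G : topologicalZmodType)
    (phi : {additive R -> G}) :
  hausdorff_space G -> continuous phi -> range phi = [set: G] ->
  ~ injective phi -> metrizable R G.
Proof.
move=> hG cphi sphi ninj.
have /choice[r rE] : forall g, exists x, phi x = g.
  by move=> g; have : [set: G] g by []; rewrite -sphi => -[x _ <-]; exists x.
pose S : set R := phi @^-1` [set 0].
have cS : closed S.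
  by apply: continuous_preimage_closed => //; exact: hausdorff_closed1.
have S0 : S 0 by rewrite /S/= raddf0.
have SB x y : S x -> S y -> S (x - y).
  by rewrite /S/= raddfB => -> ->; rewrite subrr.
have Sr x : S (r (phi x) - x) by rewrite /S/= raddfB rE subrr.
have [ST|[b b0 Sb]] := closed_subgroup_real cS S0 SB.
  have G0 (g : G) : g = 0.
    by rewrite -(rE g); have : [set: R] (r g) by []; rewrite -ST.
  apply: (@compact_metrizable_of_coordinates R G (fun=> 0) (fun=> 0)) => //.
  - have -> : [set: G] = [set 0] by apply/seteqP; split=> // g _; exact: G0.
    exact: compact_set1.
  - by move=> x; exact: cvg_cst.
  - by move=> x; exact: cvg_cst.
  - by move=> x y _ _; rewrite (G0 x) (G0 y).
have bpos : 0 < b.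
  rewrite lt_neqAle b0 andbT eq_sym; apply/eqP => bz; apply: ninj => x y xy.
  have : S (x - y) by rewrite /S/= raddfB xy subrr.
  rewrite Sb => -[k _]; rewrite bz mul0rz => /esym/eqP.
  by rewrite subr_eq0 => /eqP.
have phiI : phi @` `[0, b]%classic = [set: G].
  apply/seteqP; split=> // g _.
  have /andP[h0 h1] := floor_div_itv (r g) bpos.
  exists (r g - b *~ Num.floor (r g / b)); first by rewrite /= in_itv/= h0 ltW.
  rewrite raddfB rE -[RHS]subr0; congr (_ - _).
  have : range (fun k : int => b *~ k) (b *~ Num.floor (r g / b)) by eexists.
  by rewrite -Sb.
have cI : compact `[0, b]%classic by exact: segment_compact.
pose w : R := (pi *+ 2) / b.
have w0 : w != 0 by rewrite mulf_neq0// ?invr_neq0 ?gt_eqF// pmulrn_lgt0// pi_gt0.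
have wb : w * b = pi *+ 2 by rewrite /w divfK// gt_eqF.
have rot := rotation_cos_sin w.
have Sper x : S x -> cos (w * x) = 1.
  rewrite Sb => -[k _ <-]; rewrite -[b *~ k]add0r.
  rewrite (rotation_period_int rot); first by rewrite mulr0 cos0.
  by rewrite wb cos2pi.
have Ec : (fun g => cos (w * r g)) \o phi = (fun x => cos (w * x)).
  apply/funext => x /=; rewrite -[r _](subrK x) addrC.
  exact: (rotation_period rot x (Sper _ (Sr x))).1.
have Es : (fun g => sin (w * r g)) \o phi = (fun x => sin (w * x)).
  apply/funext => x /=; rewrite -[r _](subrK x) addrC.
  exact: (rotation_period rot x (Sper _ (Sr x))).2.
apply: (@compact_metrizable_of_coordinates R G (fun g => cos (w * r g)) (fun g => sin (w * r g))) => //.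
- by rewrite -phiI; apply: continuous_compact => //; exact: continuous_subspaceT.
- apply: (compact_quotient_continuous hG cI cphi phiI).
  by rewrite Ec; exact: continuous_cosM.
- apply: (compact_quotient_continuous hG cI cphi phiI).
  by rewrite Es; exact: continuous_sinM.
- move=> x y cxy sxy.
  have /eqP := rotation_dist rot (r x) (r y).
  rewrite cxy sxy !subrr expr0n/= addr0 eq_sym mulf_eq0 pnatr_eq0/= subr_eq0.
  move=> /eqP/esym/cos_eq1[k]; rewrite -wb -mulrzAr => /(mulfI w0) xy.
  have : S (r x - r y) by rewrite Sb; exists k.
  by rewrite /S/= raddfB !rE => /eqP; rewrite subr_eq0 => /eqP.
Qed.

(** * Measurable rotations of the line are continuous and periodic *)

Lemma continuous_translate (V : topologicalZmodType) (t : V) :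
  continuous (fun x : V => x + t).
Proof.
move=> x.
apply: (@continuous_comp _ _ _ (fun x => (x, t)) (fun z : V * V => z.1 + z.2)).
  by apply: cvg_pair => /=; [exact: cvg_id|exact: cvg_cst].
exact: add_continuous.
Qed.

Lemma lebesgue_measure_translate (R : realType) (t : R) (A : set R) :
  measurable A ->
  @lebesgue_measure R ((fun x => x + t) @^-1` A) = lebesgue_measure A.
Proof.
move=> mA.
have mf : measurable_fun setT ((fun x => x + t) : measurableTypeR R -> measurableTypeR R).
  by apply: continuous_measurable_fun; exact: continuous_translate.
pose f : measurableTypeR R -> measurableTypeR R := fun x => x + t.
transitivity (pushforward (@lebesgue_measure R) f A); first by [].
apply/esym/lebesgue_measure_unique => //= _ [[a b]] _ <-.
rewrite /pushforward.
have -> : f @^-1` `]a, b] = `]a - t, b - t]%classic.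
  by apply/seteqP; split=> x /=; rewrite !in_itv/= /f ltrBlDr lerBrDr.
rewrite !lebesgue_measure_itv/= !lte_fin ltrD2r.
by case: ifP => // _; congr (_%:E); ring.
Qed.


(** Squeeze a compact [K] and an open [U] with [K <= E], [K <= U] and
    [mu U < 2 mu K].  For small [t] the translate [K - t] still lies in [U], so
    it is too big to be disjoint from [K]; a common point is a representation
    of [t] as a difference. *)
Lemma steinhaus (R : realType) (E : set R) :
  measurable E -> (0 < @lebesgue_measure R E)%E ->
  \forall t \near (0 : R), exists x y, [/\ E x, E y & x - y = t].
Proof.
move=> mE; rewrite (lebesgue_regularity_inner_sup mE).
move=> /ereal_sup_gt[_ [K [cK KE] <-] K0].
have Koo := compact_finite_measure cK.
have mK := compact_measurable cK.
have Kfin : @lebesgue_measure R K \is a fin_num by rewrite ge0_fin_numE.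
have k0 : 0 < fine (@lebesgue_measure R K) by rewrite fine_gt0// K0 Koo.
have [U [oU KU UK]] := lebesgue_regularity_outer mK Koo k0.
have near_sub : \forall t \near (0 : R), K `<=` [set x | U (x - t)].
  move/compact_near_coveringP : cK => /(_ R (nbhs (0:R)) (fun t x => U (x - t)) _); apply => x Kx.
  have cB : {for (x, 0 : R), continuous (fun z : R * R => z.1 - z.2)}.
    exact: sub_continuous.
  have : nbhs (x - 0) U by rewrite subr0; apply: open_nbhs_nbhs; split=> //; exact: KU.
  by move/cB.
near=> t.
have tK : K `<=` [set x | U (x - t)] by near: t; exact: near_sub.
apply: contrapT => hn.
pose Kt := (fun x => x + t) @^-1` K.
have mKt : measurable Kt.
  rewrite /Kt -[X in measurable X]setTI.
  exact: (continuous_measurable_fun (@continuous_translate R t)).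
have dK : K `&` Kt = set0.
  apply/seteqP; split=> // x [Kx Kxt]; apply: hn.
  by exists (x + t), x; split; [exact: KE|exact: KE|ring].
have KtU : K `|` Kt `<=` U.
  by move=> x [/KU//|/tK/=]; rewrite addrK.
pose mu : {measure set (measurableTypeR R) -> \bar R} := @lebesgue_measure R.
have muKt : mu Kt = mu K by exact: lebesgue_measure_translate.
have muKU : (mu K + mu K <= mu U)%E.
  rewrite -{2}muKt -(measureU mu mK mKt dK).
  apply: le_measure => //; rewrite inE; first exact: measurableU.
  exact: open_measurable.
have muU : mu U = (mu (U `\` K) + mu K)%E.
  rewrite (@measureDI _ _ _ mu U K (open_measurable oU) mK).
  by rewrite (setIidr KU).
have Kfin' : mu K \is a fin_num by [].
move: muKU; rewrite muU (leeD2rE _ _ Kfin') leNgt => /negP; apply.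
by move: UK; rewrite fineK.
Unshelve. all: by end_near. Qed.

Lemma positive_measure_of_countable_cover (R : realType) (I : countType)
    (F : I -> set R) :
  (forall i, measurable (F i)) -> \bigcup_i F i = [set: R] ->
  exists i, (0 < @lebesgue_measure R (F i))%E.
Proof.
move=> mF cF; apply: contrapT => hn.
pose mu : {measure set (measurableTypeR R) -> \bar R} := @lebesgue_measure R.
have F0 i : mu (F i) = 0%E.
  apply/eqP; rewrite eq_le measure_ge0 andbT leNgt; apply/negP => Fi.
  by apply: hn; exists i.
have : mu.-negligible (\bigcup_n (if unpickle n is Some i then F i else set0)).
  apply: negligible_bigcup => n; case: unpickle => [i|].
    by apply/negligibleP; [exact: mF|exact: F0].
  exact: negligible_set0.
have -> : \bigcup_n (if unpickle n is Some i then F i else set0) = [set: R].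
  apply/seteqP; split=> // x _; have : [set: R] x by [].
  by rewrite -cF => -[i _ Fx]; exists (pickle i) => //; rewrite pickleK.
move=> [A [mA A0 TA]].
have AT : A = [set: R] by apply/seteqP; split=> // x _; exact: TA.
by move: A0; rewrite AT -set_itvNyy /mu /= lebesgue_measure_itv.
Qed.


(** Cut the plane into countably many squares of side [d].  The preimage of
    one of them has positive measure, so by Steinhaus every small [t] is a
    difference of two points whose images lie in the same square. *)
Lemma measurable_rotation_near0 (R : realType) (c s : R -> R) :
  rotation c s -> measurable_fun setT c -> measurable_fun setT s ->
  forall e, 0 < e -> \forall t \near (0 : R), 1 - c t < e.
Proof.
move=> rot mc ms e e0; pose d := Num.min 1 e.
have d0 : 0 < d by rewrite lt_min ltr01.
have d1 : d <= 1 by rewrite ge_min lexx.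
have de : d <= e by rewrite ge_min lexx orbT.
pose cell (i : int) := `[d *~ i, d *~ i + d[%classic.
have cell_floor y : cell (Num.floor (y / d)) y.
  have /andP[h1 h2] := floor_div_itv y d0.
  by rewrite /cell/= in_itv/=; apply/andP; split; lra.
have cell_close i y z : cell i y -> cell i z -> (y - z) ^+ 2 < d ^+ 2.
  rewrite /cell/= !in_itv/= => /andP[h1 h2] /andP[h3 h4].
  by rewrite -ltr_sqrt ?exprn_gt0// !sqrtr_sqr (gtr0_norm d0) ltr_norml; lra.
pose F (p : int * int) : set R := c @^-1` cell p.1 `&` s @^-1` cell p.2.
have mF p : measurable (F p).
  apply: measurableI.
    by rewrite -[X in measurable X]setTI; apply: mc => //; exact: measurable_itv.
  by rewrite -[X in measurable X]setTI; apply: ms => //; exact: measurable_itv.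
have [|[i j]] := positive_measure_of_countable_cover mF.
  apply/seteqP; split=> // x _.
  by exists (Num.floor (c x / d), Num.floor (s x / d)) => //; split; exact: cell_floor.
move/(steinhaus (mF _)); apply: filterS => t [x [y [[cx sx] [cy sy] <-]]].
have h1 := cell_close _ _ _ cx cy; have h2 := cell_close _ _ _ sx sy.
have := rotation_dist rot x y; nra.
Qed.

Lemma rotation_continuous (R : realType) (c s : R -> R) :
  rotation c s ->
  (forall e, 0 < e -> \forall t \near (0 : R), 1 - c t < e) ->
  continuous c.
Proof.
move=> rot near0 x; apply/cvgrPdist_lt => e e0.
have /near0 h : 0 < e ^+ 2 / 2 by rewrite divr_gt0// exprn_gt0.
have ct : (y - x) @[y --> x] --> (0 : R).
  by rewrite -[X in _ --> X](subrr x); exact: (@continuous_translate R (- x)).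
have hx : \forall y \near x, 1 - c (y - x) < e ^+ 2 / 2 by exact: (ct _ h).
apply: filterS hx => y hy.
have := rotation_dist rot y x; have := sqr_ge0 (s y - s x) => h1 h2.
rewrite distrC -ltr_sqr ?nnegrE ?normr_ge0 ?ltW// real_normK ?num_real//.
by move: h1 h2 hy; lra.
Qed.


(** As long as [c > 0], doubling the argument at least doubles [1 - c]; since
    [1 - c < 1], this can go on for ever only if [1 - c = 0]. *)
Lemma rotation_vanishes_or_trivial (R : realType) (V : zmodType) (c s : V -> R) :
  rotation c s -> (exists x, c x <= 0) \/ forall x, c x = 1.
Proof.
move=> rot; have [[x cx]|hn] := pselect (exists x, c x <= 0); first by left; exists x.
right=> x; apply: contrapT => cx1.
have cpos y : 0 < c y by rewrite ltNge; apply/negP => cy; apply: hn; exists y.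
have D0 : 0 < 1 - c x.
  rewrite subr_gt0 lt_neqAle (rotation_le1 rot) andbT; exact/eqP.
have dbl n : 2 ^+ n * (1 - c x) <= 1 - c (x *+ (2 ^ n)).
  elim: n => [|n IH]; first by rewrite expr0 mul1r.
  rewrite expnSr mulrnA (rotation_double rot) exprSr.
  by have := cpos (x *+ (2 ^ n)); have := rotation_le1 rot (x *+ (2 ^ n)); nra.
have [n hn1] : exists n : nat, (1 - c x)^-1 < n%:R.
  by exists (Num.bound (1 - c x)^-1); rewrite archi_boundP// invr_ge0 ltW.
have : 1 < 2 ^+ n * (1 - c x).
  rewrite -ltr_pdivrMr// div1r (lt_le_trans hn1)// -natrX ler_nat ltnW//.
  exact: ltn_expl.
by have := dbl n; have := cpos (x *+ (2 ^ n)); lra.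
Qed.


(** If [c] vanishes at [x], then [c (2 x) = -1] and [c (4 x) = 1]. *)
Lemma rotation_has_period (R : realType) (c s : R -> R) :
  rotation c s -> continuous c -> exists2 a, a != 0 & c a = 1.
Proof.
move=> rot cc; have [[z cz]|c1] := rotation_vanishes_or_trivial rot; last first.
  by exists 1; rewrite ?oner_neq0.
have [c0 _] := rotation0 rot.
wlog z0 : z cz / 0 <= z.
  move=> H; have [/H|zn] := leP 0 z; first exact.
  by apply: (H (- z)); rewrite ?(rotationN rot z).1// oppr_ge0 ltW.
have [||x _ cx] := @IVT R c 0 z 0 z0.
- exact: continuous_subspaceT.
- by rewrite c0 ge_min le_max cz ler01 orbT.
exists ((x *+ 2) *+ 2); last first.
  by rewrite !(rotation_double rot) cx; ring.
apply/eqP => /eqP; rewrite -mulrnA mulrn_eq0/= => /eqP x0.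
by move: cx; rewrite x0 c0 => /eqP; rewrite oner_eq0.
Qed.

(** * The topology of the circle in coordinates *)

Definition circle_re (R : realType) (z : circle R) : R := complex.Re (\val z).
Definition circle_im (R : realType) (z : circle R) : R := complex.Im (\val z).


(** Common to the real and the imaginary part: additive and bounded by the
    norm. *)
Lemma circle_continuous_coord (R : realType) (p : R[i]^o -> R) :
  (forall z w, p (z - w) = p z - p w) ->
  (forall z, `|p z|%:C%C <= `|z|) ->
  continuous (fun z : circle R => p (\val z)).
Proof.
move=> pB pn z.
apply: (@continuous_comp _ _ _ (fun z : circle R => \val z : R[i]^o) p z).
  exact: initial_continuous.
apply/(@cvgrPdist_lt _ _ _ _ (nbhs_filter (\val z : R[i]^o))) => e e0.
have ec0 : 0 < e%:C%C :> R[i] by rewrite ltcR.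
have hb : nbhs (\val z : R[i]^o) (ball (\val z : R[i]^o) e%:C%C).
  exact: nbhsx_ballx.
apply: (@filterS _ (nbhs (\val z : R[i]^o)) _ _ _ _ hb) => w /= zw.
by rewrite -pB -ltcR; apply: le_lt_trans zw; exact: pn.
Qed.

Lemma circle_re_continuous (R : realType) : continuous (@circle_re R).
Proof.
apply: (@circle_continuous_coord R (@complex.Re R)) => [[a b] [c d] //|[a b]].
rewrite normc_def lecR /= -sqrtr_sqr ler_sqrt ?addr_ge0 ?sqr_ge0//.
by rewrite lerDl sqr_ge0.
Qed.

Lemma circle_im_continuous (R : realType) : continuous (@circle_im R).
Proof.
apply: (@circle_continuous_coord R (@complex.Im R)) => [[a b] [c d] //|[a b]].
rewrite normc_def lecR /= -sqrtr_sqr ler_sqrt ?addr_ge0 ?sqr_ge0//.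
by rewrite lerDr sqr_ge0.
Qed.

Lemma circle_sqr (R : realType) (z : circle R) :
  circle_re z ^+ 2 + circle_im z ^+ 2 = 1.
Proof.
have /set_mem/= z1 := valP z; rewrite /circle_re /circle_im.
by apply: complexI; rewrite add_Re2_Im2 z1 expr1n.
Qed.

Lemma circle_nbhs (R : realType) (z : circle R) (W : set (circle R)) :
  nbhs z W -> exists2 e, 0 < e & forall w,
    (circle_re z - circle_re w) ^+ 2 + (circle_im z - circle_im w) ^+ 2 < e ->
    W w.
Proof.
move=> [_ [[V oV <-] /= Vz VW]].
have /nbhs_ballP[[e e'] /= e0 eV] : nbhs (\val z : R[i]^o) V.
  exact: open_nbhs_nbhs.
move: e0; rewrite ltcE/= => /andP[/eqP e'0 e0]; subst e'.
exists (e ^+ 2); first by rewrite exprn_gt0.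
move=> w zw; apply: VW => /=; apply: eV; rewrite /ball/=.
rewrite normc_def ltcR -(gtr0_norm e0) -sqrtr_sqr ltr_sqrt ?exprn_gt0//.
by move: zw; rewrite /circle_re /circle_im !set_valE /=; case: (sval z) (sval w) => [a b] [c d].
Qed.

Lemma circle_pair_norm (R : realType) (x y : R) : x ^+ 2 + y ^+ 2 = 1 ->
  `|(x +i* y)%C : R[i]^o| = 1.
Proof. by move=> xy; rewrite normc_def/= xy sqrtr1. Qed.

Definition mk_circle (R : realType) (x y : R) (xy : x ^+ 2 + y ^+ 2 = 1) : circle R :=
  SigSub (mem_set (circle_pair_norm xy)).

Lemma circle_hom_rotation (R : realType) (V : zmodType) (f : V -> circle R) :
  circle_hom f <-> rotation (@circle_re R \o f) (@circle_im R \o f).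
Proof.
split=> [hf|[_ cD sD] x y].
  split=> [x|x y|x y] /=; first exact: circle_sqr.
    rewrite /circle_re hf; rewrite /circle_im.
    by case: (\val (f x)) (\val (f y)) => [a b] [c d].
  rewrite /circle_im hf; rewrite /circle_re.
  by case: (\val (f x)) (\val (f y)) => [a b] [c d] /=; rewrite addrC.
have := cD x y; have := sD x y; rewrite /circle_re /circle_im /=.
case: (\val (f x)) (\val (f y)) (\val (f (x + y))) => [a b] [c d] [u v] /= -> ->.
by apply/eqP; rewrite eq_complex/= eqxx addrC eqxx.
Qed.

(** * Borel sets along a one-parametric group *)

Lemma Borel_preimage_measurable (R : realType) (G : topologicalType)
    (phi : R -> G) (B : set G) :
  continuous phi -> <<s @open G >> B -> measurable (phi @^-1` B).
Proof.
move=> cphi; move: B; apply: smallest_sub => [|B oB]; last first.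
  by apply: open_measurable; move/continuousP: cphi; exact.
split=> [|A mA|A mA] /=.
- by rewrite preimage_set0.
- by rewrite setTD preimage_setC; exact: measurableC.
- by rewrite preimage_bigcup; exact: bigcupT_measurable.
Qed.

Lemma open_bigcup_compact (R : realType) (U : set R) : open U ->
  exists2 F : nat -> set R, (forall n, compact (F n)) & U = \bigcup_n F n.
Proof.
move=> oU.
(* Points of the n-th interval at distance at least [1 / (n + 1)] from the
   complement of [U]. *)
pose F n : set R := `[- n%:R, n%:R] `&` \bigcap_(y in ~` U) ~` ball y n.+1%:R^-1.
exists F => [n|].
  apply: compact_closedI; first exact: segment_compact.
  apply: closed_bigI => y _; apply: open_closedC; exact: ball_open.
apply/seteqP; split=> [x Ux|x [n _ [_ Fx]]]; last first.
  by apply: contrapT => nUx; apply: (Fx x nUx); exact: ballxx.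
have /nbhs_ballP[e /= e0 eU] : nbhs x U by exact: open_nbhs_nbhs.
(* Large enough for both constraints defining [F n]. *)
pose n := (Num.bound `|x| + Num.bound e^-1)%N.
have n1 : `|x| < n%:R.
  by rewrite natrD ltr_wpDr ?ler0n// archi_boundP.
have n2 : e^-1 < n.+1%:R.
  have ei : 0 <= e^-1 by rewrite invr_ge0 ltW.
  apply: lt_le_trans (archi_boundP ei) _.
  by rewrite ler_nat /n -addSn leq_addl.
exists n => //; split; first by rewrite /= in_itv/= -ler_norml ltW.
move=> y nUy /ball_sym xy; apply: nUy; apply: eU; apply: le_ball xy.
by rewrite -[leRHS]invrK lef_pV2 ?posrE ?invr_gt0// ltW.
Qed.


(** An open set of reals is a countable union of compact sets, and the images
    of these are closed.  So a continuous injection of the line is a Borel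
    isomorphism onto its image, however coarse the topology of the image. *)
Lemma open_image_Borel (R : realType) (G : topologicalType) (phi : R -> G) (U : set R) :
  hausdorff_space G -> continuous phi -> open U -> <<s @open G >> (phi @` U).
Proof.
move=> hG cphi /open_bigcup_compact[F cF ->].
rewrite image_bigcup; apply: sigma_algebra_bigcup => n.
have cl : closed (phi @` F n).
  apply: compact_closed => //; apply: continuous_compact => //.
  exact: continuous_subspaceT.
rewrite -[_ @` _]setCK -setTD; apply: sigma_algebraCD.
by apply: sub_sigma_algebra; exact: closed_openC.
Qed.


(** Automatic continuity: on the line, every Borel character of [G] becomes an
    ordinary continuous character. *)
Lemma Borel_character_along_line (R : realType) (G : topologicalZmodType)
    (phi : {additive R -> G}) (f : G -> circle R) :
  continuous phi -> Borel_fun f -> circle_hom f ->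
  let c := @circle_re R \o f \o phi in
  let s := @circle_im R \o f \o phi in
  rotation c s /\ continuous c.
Proof.
move=> cphi bf /circle_hom_rotation[cs cD sD] c s.
have rot : rotation c s.
  split=> [x|x y|x y]; first exact: cs.
    by rewrite /c /s /= raddfD; exact: cD.
  by rewrite /c /s /= raddfD; exact: sD.
have mes (p : circle R -> R) : continuous p -> measurable_fun setT ((p \o f \o phi) : R -> R).
  move=> cp; apply: (measurability _ (RGenOpens.measurableE R)).
  move=> _ [_ [a [b ->] <-]]; rewrite setTI.
  apply: (@Borel_preimage_measurable R G phi (f @^-1` (p @^-1` `]a, b[))) => //.
  apply: bf; move/continuousP: cp; apply; exact: interval_open.
split=> //; apply: (rotation_continuous rot) => e.
apply: (measurable_rotation_near0 rot); apply: mes.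
  exact: circle_re_continuous.
exact: circle_im_continuous.
Qed.

(** * Neighbourhoods in the scaled and Borel-Bohr topologies *)

Lemma Nscaling_open_at0 (G : topologicalZmodType) (O : set G) :
  Nscaling_topology G O -> O 0 ->
  exists n (U : set G), [/\ (0 < n)%N, open U, U 0 & forall u, U u -> O (u *+ n)].
Proof.
move=> [D sD <-] [B DB B0]; have [g [n [U [n0 oU U0 BE]]]] := sD _ DB.
move: B0; rewrite BE => -[v Uv gv].
exists n, ((fun u => u + v) @^-1` U); split=> //.
- by move/continuousP: (@continuous_translate G v); exact.
- by rewrite /= add0r.
- move=> u Uuv; exists B => //; rewrite BE; exists (u + v) => //.
  by rewrite mulrnDl addrCA gv addr0.
Qed.

Lemma Nscaling_nbhs (G : topologicalZmodType) (x : G) n (U : set G) :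
  (0 < n)%N -> open U -> U 0 ->
  nbhs (x : Nscaling G) (scaled_translate x n U).
Proof.
move=> n0 oU U0; apply: open_nbhs_nbhs; split; last first.
  by exists 0 => //; rewrite mul0rn addr0.
exists [set scaled_translate x n U]; last by rewrite bigcup_set1.
by move=> _ ->; exists x, n, U.
Qed.

Lemma Borel_Bohr_open_preimage (R : realType) (G : topologicalZmodType)
    (f : G -> circle R) (W : set (circle R)) :
  Borel_fun f -> circle_hom f -> open W -> Borel_Bohr_topology R G (f @^-1` W).
Proof.
move=> bf hf oW; pose i : Borel_character R G := exist _ f (conj bf hf).
rewrite /Borel_Bohr_topology openE => x Wx.
have /cvg_sup/(_ i) cx : nbhs (x : Borel_Bohr R G) --> (x : Borel_Bohr R G).
  exact: cvg_id.
apply: cx; apply: open_nbhs_nbhs; split=> //.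
by exists W.
Qed.

Lemma Borel_Bohr_sub_Nscaling (R : realType) (G : topologicalZmodType) :
  (forall (f : G -> circle R) (x : G) (W : set (circle R)),
    Borel_fun f -> circle_hom f -> nbhs (f x) W ->
    nbhs (x : Nscaling G) (f @^-1` W)) ->
  Borel_Bohr_topology R G `<=` Nscaling_topology G.
Proof.
move=> H O oO; rewrite /Nscaling_topology openE => x Ox.
have : nbhs (x : Borel_Bohr R G) O by apply: open_nbhs_nbhs; split.
suff : nbhs (x : Nscaling G) --> (x : Borel_Bohr R G) by exact.
apply/cvg_sup => -[f [bf hf]] A /= [_ [[V oV <-] Vx VA]].
apply: filterS VA _; apply: H => //.
exact: open_nbhs_nbhs.
Qed.

(** * The two implications *)

Lemma closure_subgroup (G : topologicalZmodType) (A : set G) :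
  (forall x y, A x -> A y -> A (x - y)) ->
  forall x y, closure A x -> closure A y -> closure A (x - y).
Proof.
move=> AB x y Ax Ay B Bxy.
have [[P Q] /= [Px Qy] PQ] := @sub_continuous G (x, y) B Bxy.
have [u [Au Pu]] := Ax _ Px; have [v [Av Qv]] := Ay _ Qy.
by exists (u - v); split; [exact: AB|exact: (PQ (u, v))].
Qed.

Lemma dense_of_closure (T : topologicalType) (A : set T) :
  closure A = setT -> dense A.
Proof.
move=> cA O [x Ox] oO; have : closure A x by rewrite cA.
by move=> /(_ O) [|y [Ay Oy]]; [exact: open_nbhs_nbhs|exists y].
Qed.


(** When [phi] is onto, [G / K] is the circle [R / b Z], and the lemma says
    that [x |-> c (n x)], which factors through it, is continuous at 0 for the
    topology of [G].  The points of [[0, b]] where [c (n x)] is at least [e]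
    away from 1 form a compact set whose image misses the closed subgroup [K]; a
    neighbourhood of 0 in [G] keeps missing [K] after subtracting that image,
    and reducing [x] modulo [b] only moves [phi x] by an element of [K]. *)
Lemma rotation_continuous_at0_along_lattice (R : realType) (G : topologicalZmodType)
    (phi : {additive R -> G}) (K : set G) (c s : R -> R) (b : R) (n : nat) :
  continuous phi -> closed K ->
  phi @^-1` K = range (fun k : int => b *~ k) -> 0 < b ->
  rotation c s -> continuous c -> c (b *+ n) = 1 ->
  forall e, 0 < e -> exists U : set G,
    [/\ open U, U 0 & forall x, U (phi x) -> 1 - c (x *+ n) < e].
Proof.
move=> cphi cK KE b0 rot cc cb e e0.
have cper k : c ((b *~ k) *+ n) = 1.
  have -> : (b *~ k) *+ n = 0 + (b *+ n) *~ k.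
    by rewrite add0r pmulrn mulrzAC -pmulrn.
  by rewrite (rotation_period_int rot) //; exact: (rotation0 rot).1.
pose C : set R := `[0, b] `&` (fun y => c (n%:R * y)) @^-1` [set u | u <= 1 - e].
have cg : continuous (fun y : R => c (n%:R * y)).
  move=> y; apply: (@continuous_comp R R R (fun y => n%:R * y) c).
    exact: mulrl_continuous.
  exact: cc.
have cC : compact C.
  apply: compact_closedI; first exact: segment_compact.
  apply: continuous_preimage_closed; last exact: closed_le.
  exact: cg.
have : nbhs (0 : G) [set g | C `<=` [set y | ~ K (g - phi y)]].
  move/compact_near_coveringP : cC.
  move=> /(_ G (nbhs (0 : G)) (fun g y => ~ K (g - phi y)) _); apply => y [_ Cy].
  have nK : ~ K (0 - phi y).
    rewrite sub0r -raddfN => KNy; have : (phi @^-1` K) (- y) by [].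
    rewrite KE => -[k _ ky].
    have : c (n%:R * y) = 1.
      by rewrite mulr_natl -[y]opprK -ky mulNrn (rotationN rot _).1.
    by move: Cy => /=; lra.
  have cF : {for (y, 0 : G), continuous (fun z : R * G => z.2 - phi z.1)}.
    apply: (@continuous_comp _ _ _ (fun z : R * G => (z.2, phi z.1))
      (fun z : G * G => z.1 - z.2)); last exact: sub_continuous.
    apply: cvg_pair => /=; first exact: cvg_snd.
    by apply: continuous_cvg; [exact: cphi|exact: cvg_fst].
  have oK : nbhs (0 - phi y) (~` K).
    by apply: open_nbhs_nbhs; split=> //; exact: closed_openC.
  exact: (cF _ oK).
rewrite nbhsE => -[U [oU U0] UC]; exists U; split=> // x Ux.
rewrite ltNge; apply/negP => ex.
pose k := Num.floor (x / b); have /andP[y0 y1] := floor_div_itv x b0.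
have Kk : K (phi (b *~ k)).
  have : range (fun k : int => b *~ k) (b *~ k) by exists k.
  by rewrite -KE.
apply: (UC _ Ux (x - b *~ k)); last by rewrite -raddfB opprB addrC subrK.
split; first by rewrite /= in_itv/= y0 ltW.
rewrite /= mulr_natl.
have -> : (x - b *~ k) *+ n = x *+ n - (b *~ k) *+ n by rewrite mulrnBl.
have h : c (- ((b *~ k) *+ n)) = 1 by rewrite (rotationN rot _).1.
by rewrite (rotation_period rot _ h).1; lra.
Qed.


(** Let [a] be a nonzero period of a Borel character [f] along the line and
    [K] the closure of the multiples of [phi a].  If [K <> G], the pullback of
    [K] to the line is some [b Z] with [a = m b], and the previous lemma makes
    [x |-> f (m x)] continuous at 0 on [G].  This is continuity of [f] for the
    scaled topology. *)
Lemma not_Borel_Bohr_sub_monothetic (R : realType) (G : topologicalZmodType)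
    (phi : {additive R -> G}) :
  continuous phi -> range phi = [set: G] ->
  ~ (Borel_Bohr_topology R G `<=` Nscaling_topology G) -> monothetic G.
Proof.
move=> cphi sphi; apply: contra_notP => nmono.
apply: Borel_Bohr_sub_Nscaling => f x W bf hf Wfx.
have [rot cc] := Borel_character_along_line cphi bf hf.
set c := @circle_re R \o f \o phi in rot cc.
have [a a0 ca] := rotation_has_period rot cc.
pose Z := range (fun k : int => phi a *~ k).
pose K := closure Z.
have KB : forall x y, K x -> K y -> K (x - y).
  apply: closure_subgroup => _ _ [i _ <-] [j _ <-].
  by exists (i - j) => //; rewrite mulrzBr.
have ZK k : K (phi a *~ k) by apply: subset_closure; exists k.
have cK : closed K by exact: closed_closure.
have cS : closed (phi @^-1` K) by exact: continuous_preimage_closed.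
have [||ST|[b b0 Sb]] := closed_subgroup_real cS.
- by rewrite /= raddf0; have := ZK 0; rewrite mulr0z.
- by move=> u v Ku Kv /=; rewrite raddfB; exact: KB.
- case: nmono; exists (phi a); apply: dense_of_closure.
  apply/seteqP; split=> // y _; have : [set: G] y by [].
  rewrite -sphi => -[t _ <-]; have : [set: R] t by [].
  by rewrite -ST.
have [m am] : exists m : int, b *~ m = a.
  have : (phi @^-1` K) a by have := ZK 1; rewrite mulr1z.
  by rewrite Sb => -[m _ ma]; exists m.
have m0 : (0 < `|m|)%N.
  by rewrite absz_gt0; apply: contraNneq a0 => m0; rewrite -am m0 mulr0z.
have bpos : 0 < b.
  rewrite lt_neqAle b0 andbT eq_sym; apply: contraNneq a0 => bz.
  by rewrite -am bz mul0rz.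
have cb : c (b *+ `|m|%N) = 1.
  rewrite -ca -am; case: (m) => n //.
  by rewrite NegzE mulrNz (rotationN rot _).1 abszN.
(* [|m|] is the scale: [f] maps [x + |m| U] into [W] for a suitable [U]. *)
have [e e0 eW] := circle_nbhs Wfx.
have e20 : 0 < e / 2 by rewrite divr_gt0.
have [U [oU U0 UE]] := rotation_continuous_at0_along_lattice cphi cK Sb bpos rot cc cb e20.
apply: filterS (Nscaling_nbhs x m0 oU U0) => _ [u Uu <-] /=; apply: eW.
have rotG := proj1 (circle_hom_rotation f) hf.
have := rotation_dist rotG x (x + u *+ `|m|%N).
rewrite opprD addNKr => /= ->; rewrite [_ (f (- _))](rotationN rotG _).1 /=.
have : [set: G] u by []; rewrite -sphi => -[t _ tu].
by move: Uu; rewrite -tu => /UE; rewrite /c /= raddfMn; lra.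
Qed.


(** Take the character [f] of the line whose period [a] is carried to the
    topological generator [g].  Continuity in the scaled topology would give
    [n] and a neighbourhood [U] of 0 such that [f] has positive real part on
    [n U].  But [phi (a / 2n)] is a multiple of [g] plus some [u] in [U], and
    then [f (n u) = f (phi (a / 2)) = -1]. *)
Lemma monothetic_not_Borel_Bohr_sub (R : realType) (G : topologicalZmodType)
    (phi : {additive R -> G}) :
  hausdorff_space G -> continuous phi -> range phi = [set: G] ->
  injective phi -> monothetic G ->
  ~ (Borel_Bohr_topology R G `<=` Nscaling_topology G).
Proof.
move=> hG cphi sphi iphi [g dg] sub.
have /choice[r rE] : forall x, exists t, phi t = x.
  by move=> x; have : [set: G] x by []; rewrite -sphi => -[t _ <-]; exists t.
have rphi t : r (phi t) = t by apply: iphi; rewrite rE.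
have rD x y : r (x + y) = r x + r y by apply: iphi; rewrite raddfD !rE.
pose a := r g.
(* The multiples of 0 are not dense, as [G] is Hausdorff and not trivial. *)
have a0 : a != 0.
  apply/eqP => az.
  have g0 : g = 0 by rewrite -(rE g) -/a az raddf0.
  have [||y [y0 [k _ ky]]] := dg (~` [set 0]).
  - exists (phi 1) => /= phi1; have : (1 : R) = 0 by apply: iphi; rewrite raddf0.
    by move/eqP; rewrite oner_eq0.
  - exact/closed_openC/hausdorff_closed1.
  by apply: y0; rewrite /= -ky g0 mul0rz.
pose w := (pi *+ 2) / a.
have wa : w * a = pi *+ 2 by rewrite /w divfK.
pose f (x : G) : circle R := mk_circle (cos2Dsin2 (w * r x)).
have hf : circle_hom f.
  apply/circle_hom_rotation; have [cs cD sD] := rotation_cos_sin w.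
  split=> [x|x y|x y]; rewrite /circle_re /circle_im /=; first exact: cs.
    by rewrite rD; exact: cD.
  by rewrite rD; exact: sD.
have cfphi : continuous (f \o phi).
  move=> t W /circle_nbhs[e e0 eW].
  have e20 : 0 < e / 2 by rewrite divr_gt0.
  have c1 : cos (w * (t - t)) = 1 by rewrite subrr mulr0 cos0.
  have cc : (fun y => cos (w * (t - y))) @ t --> (1 : R).
    rewrite -[X in _ --> X]c1.
    apply: (@continuous_comp _ _ _ (fun y => t - y) (fun y => cos (w * y))).
      by apply: cvgB; [exact: cvg_cst|exact: cvg_id].
    exact: continuous_cosM.
  apply: filterS (cvgr_dist_lt _ _ cc _ e20) => y hy; apply: eW => /=.
  rewrite /circle_re /circle_im /= !rphi (rotation_dist (rotation_cos_sin w)).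
  by move: hy; rewrite ltr_norml => /andP[_]; lra.
have bf : Borel_fun f.
  move=> W oW.
  have -> : f @^-1` W = phi @` ((f \o phi) @^-1` W).
    apply/seteqP; split=> [x Wx|_ [t Wt <-] //].
    by exists (r x); rewrite /= rE.
  by apply: open_image_Borel => //; move/continuousP: cfphi; exact.
pose W : set (circle R) := @circle_re R @^-1` [set u | 0 < u].
have oW : open W.
  by move/continuousP: (@circle_re_continuous R); apply; exact: open_gt.
have r0 : r 0 = 0 by apply: iphi; rewrite rE raddf0.
have [|n [U [n0 oU U0 UE]]] :=
  Nscaling_open_at0 (sub _ (Borel_Bohr_open_preimage bf hf oW)).
  by rewrite /W /= /circle_re /= r0 mulr0 cos0 ltr01.
pose h := a / (2 * n%:R).
have [||y [Uy [k _ ky]]] := dg ((fun x => phi h - x) @^-1` U).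
- by exists (phi h); rewrite /= subrr.
- apply: open_comp => // x _.
  apply: (@continuous_comp _ _ _ (fun x => (phi h, x)) (fun z : G * G => z.1 - z.2)).
    by apply: cvg_pair => /=; [exact: cvg_cst|exact: cvg_id].
  exact: sub_continuous.
have := UE _ Uy.
have nn0 : n%:R != 0 :> R by rewrite pnatr_eq0 -lt0n.
have -> : (phi h - y) *+ n = phi (a / 2 + a *~ (- (k * n%:Z))).
  rewrite -ky -(rE g) -/a -raddfMz -raddfB -raddfMn; congr (phi _).
  rewrite mulrnBl; congr (_ + _); first by rewrite -mulr_natr /h; field.
  by rewrite mulrNz mulrzA -pmulrn.
rewrite /W /= /circle_re /= rphi.
rewrite (rotation_period_int (rotation_cos_sin w)); last by rewrite wa cos2pi.
have -> : w * (a / 2) = pi by rewrite mulrA wa mulr2n; field.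
by rewrite cospi ltr0N1.
Qed.

Theorem theorem7p6 (R : realType) (G : topologicalZmodType)
    (G_hausdorff : hausdorff_space G)
    (G_one_parametric : one_parametric R G)
    (G_nonmetrizable : ~ metrizable R G) :
  monothetic G <->
  ~ (Borel_Bohr_topology R G `<=` Nscaling_topology G).
Proof.
have [phi [cphi sphi]] := G_one_parametric.
have iphi : injective phi.
  by apply: contrapT => ninj; exact: G_nonmetrizable (noninjective_metrizable _ _ _ ninj).
split; first exact: (monothetic_not_Borel_Bohr_sub G_hausdorff cphi sphi iphi).
exact: not_Borel_Bohr_sub_monothetic cphi sphi.
Qed.
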